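(* Let $H\le F$ be a subgroup of Thompson's group $F$. Then $H$ acts transitively on the set of finite dyadic fractions $\mathcal D=\mathbb{Z}[\frac12]\cap(0,1)$ if and only if the following conditions are satisfied. (1) Every edge in the core $\mathcal L(H)$ is the top edge of some positive cell. (2) There is a unique inner vertex in $\mathcal L(H)$.
   Context: Thompson's group $F$ is the group of all piecewise-linear increasing homeomorphisms of $[0,1]$ with finitely many breakpoints, all in $\mathbb{Z}[\frac12]\cap(0,1)$, and all slopes integer powers of $2$. Diagrams. For a finite binary word $u$, $[u]$ is the dyadic interval $[.u,.u1^{\mathbb N}]$ (binary expansions). Each $f\in F$ has a unique reduced pair $(T_+,T_-)$ of finite rooted full binary trees with the same number $n$ of leaves such that, if $u_1,\dots,u_n$ and $v_1,\dots,v_n$ are the leaf addresses ($0$ = left, $1$ = right) from left to right of $T_+$ and $T_-$, then $f$ maps $[u_i]$ linearly onto $[v_i]$ for all $i$ (reduced: for no $i$ are leaves $i,i+1$ the two children of one node in both trees). The reduced diagram $\Delta$ of $f$ is the following directed $2$-complex. Its edges are the nodes of $T_+$ and of $T_-$, the $i$-th leaf of $T_+$ being identified with the $i$-th leaf of $T_-$. It has vertices $0,\dots,n$, and a node whose descendant leaves are the $i$-th through $j$-th is an edge directed from vertex $i-1$ to vertex $j$. For each non-leaf node $e$ of either tree there is a positive cell with top edge $e$, left bottom edge the left child of $e$ and right bottom edge the right child of $e$ (together with its formal inverse, a negative cell). The top edge of $\Delta$ is the root of $T_+$, the bottom edge of $\Delta$ is the root of $T_-$. (For the identity, $\Delta$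 is a single edge.) Core. Let $H\le F$ be generated by elements with reduced diagrams $\Delta_i$, $i\in\mathcal I$. Identify all top edges and all bottom edges of all $\Delta_i$ into one distinguished edge $p$ (with corresponding identification of endpoints). Then apply foldings as long as possible: whenever two positive cells have the same top edge, identify their left bottom edges, their right bottom edges and the cells; whenever two positive cells have the same left bottom edge and the same right bottom edge, identify their top edges and the cells (identifying edges also identifies their initial vertices and their terminal vertices). The resulting complex (a limit if infinitely many foldings are needed) with distinguished edge $p$ is the core $\mathcal L(H)$; it does not depend on the generating set or on the order of foldings. The initial vertex $\iota(\mathcal L(H))$ and terminal vertex $\tau(\mathcal L(H))$ are the initial and terminal vertices of $p$; every other vertex of $\mathcal L(H)$ is an inner vertex. *)

(* Defs.v *)
From Stdlib Require Import Relation_Operators.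
From HB Require Import structures.
From mathcomp Require Import all_boot all_order all_algebra.
From mathcomp Require Import all_classical all_reals all_analysis.

Set Implicit Arguments.
Unset Strict Implicit.
Unset Printing Implicit Defensive.

Import Order.TTheory GRing.Theory Num.Theory.
Import numFieldNormedType.Exports.

Local Open Scope classical_set_scope.
Local Open Scope ring_scope.
Local Open Scope quotient_scope.

Definition dyadic (R : realType) (x : R) : Prop :=
  exists (a : int) (k : nat), x = a%:~R / 2 ^+ k.

Definition dyadic01 (R : realType) : set R :=
  [set x | 0 < x < 1 /\ dyadic x].

(* Every subinterval [a, b] whose interior avoids the finite set [s] is mapped
   affinely, with slope an integer power of 2. *)
Definition dyadic_piecewise_linear (R : realType) (f : R -> R) : Prop :=
  exists2 s : seq R, {in s, forall x, dyadic01 x} &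
    forall a b : R, 0 <= a -> a < b -> b <= 1 ->
      {in s, forall x, ~~ (a < x < b)} ->
      exists k : int, forall x, a <= x <= b -> f x = f a + 2 ^ k * (x - a).

(* A homeomorphism of [0, 1] is represented by its extension to R by the
   identity, so that the group law is composition of functions R -> R and
   equality of elements is equality of functions. *)
Definition thompsonF (R : realType) : set (R -> R) :=
  [set f : R -> R | [/\ forall x : R, x \notin `[0, 1] -> f x = x,
               set_bij `[0, 1] `[0, 1] f,
               {within `[0, 1], continuous f},
               {in `[0, 1] &, {homo f : x y / x < y}} &
               dyadic_piecewise_linear f]].

Definition thompson_subgroup (R : realType) (H : set (R -> R)) : Prop :=
  [/\ H `<=` @thompsonF R,
      H id,
      forall f g, H f -> H g -> H (f \o g) &
      forall f g, H f -> cancel f g -> cancel g f -> H g].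

Definition transitive_on_dyadics (R : realType) (H : set (R -> R)) : Prop :=
  forall x y, dyadic01 x -> dyadic01 y -> exists2 f, H f & f x = y.

Inductive tree := Leaf | Node of tree & tree.

(* Nodes are addressed by binary words: false is left (0), true is right (1). *)
Notation word := (seq bool).

Fixpoint is_node (T : tree) (u : word) : bool :=
  match u, T with
  | [::], _ => true
  | _ :: _, Leaf => false
  | b :: u', Node l r => is_node (if b then r else l) u'
  end.

Fixpoint is_inner (T : tree) (u : word) : bool :=
  match u, T with
  | _, Leaf => false
  | [::], Node _ _ => true
  | b :: u', Node l r => is_inner (if b then r else l) u'
  end.

Fixpoint leaves (T : tree) : seq word :=
  match T with
  | Leaf => [:: [::]]
  | Node l r => map (cons false) (leaves l) ++ map (cons true) (leaves r)
  end.

Lemma is_inner_node T u : is_inner T u -> is_node T u.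
Proof. by elim: u T => [|b u IHu] [|l r] //=; case: b; apply: IHu. Qed.

Lemma is_inner_child T u b : is_inner T u -> is_node T (rcons u b).
Proof.
elim: u T => [|c u IHu] [|l r] //=; last by case: c; apply: IHu.
by case: b; [case: r | case: l].
Qed.

Record tree_pair := TreePair {
  tree_plus : tree;
  tree_minus : tree;
  size_leaves : size (leaves tree_plus) = size (leaves tree_minus) }.

(* true selects T_+, false selects T_-. *)
Definition side_tree (D : tree_pair) (s : bool) : tree :=
  if s then tree_plus D else tree_minus D.

Definition nleaves (D : tree_pair) : nat := size (leaves (tree_plus D)).

Lemma size_side_leaves D s : size (leaves (side_tree D s)) = nleaves D.
Proof. by case: s => //=; rewrite -size_leaves. Qed.

(* The left endpoint .u of [u]; the length of [u] is 2^-|u|. *)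
Fixpoint wval (R : realType) (u : word) : R :=
  match u with
  | [::] => 0
  | b :: u' => (b%:R + wval R u') / 2
  end.

Definition winterval (R : realType) (u : word) : set R :=
  `[wval R u, wval R u + 2 ^- size u].

Definition represents (R : realType) (D : tree_pair) (f : R -> R) : Prop :=
  forall i, (i < nleaves D)%N ->
    let u := nth [::] (leaves (tree_plus D)) i in
    let v := nth [::] (leaves (tree_minus D)) i in
    forall x, winterval u x ->
      f x = wval R v + (2 ^- size v / 2 ^- size u) * (x - wval R u).

Definition caret (T : tree) (i : nat) : Prop :=
  (i.+1 < size (leaves T))%N /\
  exists u, nth [::] (leaves T) i = rcons u false /\
            nth [::] (leaves T) i.+1 = rcons u true.

Definition reduced (D : tree_pair) : Prop :=
  forall i, ~ (caret (tree_plus D) i /\ caret (tree_minus D) i).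

Definition reduced_pairs (R : realType) (S : set (R -> R)) : set tree_pair :=
  [set D | exists2 f, S f & reduced D /\ represents D f].

(* Only positive cells are recorded; negative cells are their formal inverses. *)
Record complex := Complex {
  vertex : Type;
  edge : Type;
  cell : Type;
  initial : edge -> vertex;
  terminal : edge -> vertex;
  top : cell -> edge;
  lbot : cell -> edge;
  rbot : cell -> edge;
  distinguished : edge }.

Definition iota_vertex (K : complex) : vertex K := initial (distinguished K).
Definition tau_vertex (K : complex) : vertex K := terminal (distinguished K).

Definition inner_vertex (K : complex) (v : vertex K) : Prop :=
  v <> iota_vertex K /\ v <> tau_vertex K.

Definition every_edge_is_top (K : complex) : Prop :=
  forall e : edge K, exists c : cell K, top c = e.

Definition unique_inner_vertex (K : complex) : Prop :=
  exists! v : vertex K, inner_vertex v.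

Section Quot.
Variables (T : Type) (r : T -> T -> Prop).

Definition rst_rel : rel {classic T} :=
  fun x y => `[< clos_refl_sym_trans T r x y >].

Lemma rst_rel_refl : reflexive rst_rel.
Proof. by move=> x; apply/asboolP; apply: rst_refl. Qed.

Lemma rst_rel_sym : symmetric rst_rel.
Proof.
by move=> x y; apply/asboolP/asboolP => h; apply: rst_sym.
Qed.

Lemma rst_rel_trans : transitive rst_rel.
Proof.
move=> y x z /asboolP xy /asboolP yz.
by apply/asboolP; apply: (rst_trans _ _ _ y).
Qed.

Canonical rst_equiv := EquivRel rst_rel rst_rel_refl rst_rel_sym rst_rel_trans.

Definition quot : Type := {eq_quot rst_equiv}.
Definition cls (x : T) : quot := \pi_({eq_quot rst_equiv}) (x : {classic T}).
Definition rep (q : quot) : T := repr (q : {eq_quot rst_equiv}).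

Lemma clsP (x y : T) : cls x = cls y <-> clos_refl_sym_trans T r x y.
Proof.
split=> [/(@eqmodP _ rst_equiv)/asboolP // | h].
by apply/(@eqmodP _ rst_equiv)/asboolP.
Qed.

Lemma repK (q : quot) : cls (rep q) = q.
Proof. exact: reprK. Qed.

End Quot.

Section Folding.
Variables (K : complex) (glue : edge K -> edge K -> Prop).

(* The limit of the folding process: the least equivalence relation on edges
   that contains the initial identifications [glue] and admits no further
   folding. *)
Inductive fold_edge : edge K -> edge K -> Prop :=
  | FoldGlue e e' : glue e e' -> fold_edge e e'
  | FoldRefl e : fold_edge e e
  | FoldSym e e' : fold_edge e e' -> fold_edge e' e
  | FoldTrans e e' e'' : fold_edge e e' -> fold_edge e' e'' -> fold_edge e e''
  | FoldTopL c c' : fold_edge (top c) (top c') -> fold_edge (lbot c) (lbot c')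
  | FoldTopR c c' : fold_edge (top c) (top c') -> fold_edge (rbot c) (rbot c')
  | FoldBot c c' : fold_edge (lbot c) (lbot c') ->
      fold_edge (rbot c) (rbot c') -> fold_edge (top c) (top c').

Inductive fold_vertex : vertex K -> vertex K -> Prop :=
  | FoldInitial e e' : fold_edge e e' -> fold_vertex (initial e) (initial e')
  | FoldTerminal e e' : fold_edge e e' ->
      fold_vertex (terminal e) (terminal e').

Inductive fold_cell : cell K -> cell K -> Prop :=
  | FoldCellTop c c' : fold_edge (top c) (top c') -> fold_cell c c'
  | FoldCellBot c c' : fold_edge (lbot c) (lbot c') ->
      fold_edge (rbot c) (rbot c') -> fold_cell c c'.

(* The structure maps are computed on chosen representatives; the lemmas below
   show that the choice is immaterial. *)
Definition folded : complex := {|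
  vertex := quot fold_vertex;
  edge := quot fold_edge;
  cell := quot fold_cell;
  initial := fun e => cls fold_vertex (initial (rep e));
  terminal := fun e => cls fold_vertex (terminal (rep e));
  top := fun c => cls fold_edge (top (rep c));
  lbot := fun c => cls fold_edge (lbot (rep c));
  rbot := fun c => cls fold_edge (rbot (rep c));
  distinguished := cls fold_edge (distinguished K) |}.

Lemma cls_edgeP e e' :
  cls fold_edge e = cls fold_edge e' <-> fold_edge e e'.
Proof.
split=> [/clsP | h]; last by apply/clsP; apply: rst_step.
elim=> [x y //|x|x y _ |x y z _ xy _ yz].
- exact: FoldRefl.
- exact: FoldSym.
- exact: FoldTrans xy yz.
Qed.

Lemma fold_cell_edges c c' : clos_refl_sym_trans _ fold_cell c c' ->
  [/\ fold_edge (top c) (top c'), fold_edge (lbot c) (lbot c') &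
      fold_edge (rbot c) (rbot c')].
Proof.
elim=> {c c'} [c c' [{}c {}c' h|{}c {}c' h1 h2]|c|c c' _ [h1 h2 h3]|
               c1 c2 c3 _ [h1 h2 h3] _ [k1 k2 k3]].
- by split=> //; [apply: FoldTopL|apply: FoldTopR].
- by split=> //; apply: FoldBot.
- by split; apply: FoldRefl.
- by split; apply: FoldSym.
- by split; [apply: FoldTrans h1 k1|apply: FoldTrans h2 k2|
             apply: FoldTrans h3 k3].
Qed.

Lemma folded_initial (e : edge K) :
  initial (cls fold_edge e : edge folded) = cls fold_vertex (initial e).
Proof.
by apply/clsP/rst_step/FoldInitial/cls_edgeP; rewrite repK.
Qed.

Lemma folded_terminal (e : edge K) :
  terminal (cls fold_edge e : edge folded) = cls fold_vertex (terminal e).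
Proof.
by apply/clsP/rst_step/FoldTerminal/cls_edgeP; rewrite repK.
Qed.

Lemma folded_top (c : cell K) :
  top (cls fold_cell c : cell folded) = cls fold_edge (top c).
Proof.
have /clsP/fold_cell_edges[h _ _] := repK (cls fold_cell c).
exact/cls_edgeP.
Qed.

Lemma folded_lbot (c : cell K) :
  lbot (cls fold_cell c : cell folded) = cls fold_edge (lbot c).
Proof.
have /clsP/fold_cell_edges[_ h _] := repK (cls fold_cell c).
exact/cls_edgeP.
Qed.

Lemma folded_rbot (c : cell K) :
  rbot (cls fold_cell c : cell folded) = cls fold_edge (rbot c).
Proof.
have /clsP/fold_cell_edges[_ _ h] := repK (cls fold_cell c).
exact/cls_edgeP.
Qed.

End Folding.

Section Core.
Variables (I : Type) (D : I -> tree_pair).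

(* The disjoint union of all trees of the diagrams D i, together with a separate
   edge for p. The two trees of D i share the vertices 0, ..., n; their leaves
   and roots are identified in [core_glue]. *)
Inductive pre_vertex :=
  | PInitial
  | PTerminal
  | DVertex (i : I) of 'I_(nleaves (D i)).+1.

Inductive pre_edge :=
  | PEdge
  | DEdge (i : I) (s : bool) (u : word) of is_node (side_tree (D i) s) u.

Inductive pre_cell :=
  | DCell (i : I) (s : bool) (u : word) of is_inner (side_tree (D i) s) u.

Definition first_leaf (T : tree) (u : word) : nat :=
  find (prefix u) (leaves T).
Definition nleaves_below (T : tree) (u : word) : nat :=
  count (prefix u) (leaves T).

Lemma first_leaf_lt i s u :
  (first_leaf (side_tree (D i) s) u < (nleaves (D i)).+1)%N.
Proof. by rewrite ltnS -(size_side_leaves _ s) find_size. Qed.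

Lemma last_leaf_lt i s u :
  (first_leaf (side_tree (D i) s) u + nleaves_below (side_tree (D i) s) u
   < (nleaves (D i)).+1)%N.
Proof.
rewrite ltnS -(size_side_leaves _ s) /first_leaf /nleaves_below.
set a := prefix u; set l := leaves _; elim: l => //= x l IHl.
case: (a x) => /=; first by rewrite add0n add1n ltnS count_size.
by rewrite add0n addSn ltnS.
Qed.

(* Leaves are numbered from 0 here, so a node above the leaves j, ..., j+m-1
   goes from vertex j to vertex j+m. *)
Definition pre_initial (e : pre_edge) : pre_vertex :=
  match e with
  | PEdge => PInitial
  | @DEdge i s u _ => DVertex (Ordinal (first_leaf_lt i s u))
  end.

Definition pre_terminal (e : pre_edge) : pre_vertex :=
  match e with
  | PEdge => PTerminal
  | @DEdge i s u _ => DVertex (Ordinal (last_leaf_lt i s u))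
  end.

Definition pre_top (c : pre_cell) : pre_edge :=
  let: @DCell i s u h := c in DEdge (is_inner_node h).
Definition pre_lbot (c : pre_cell) : pre_edge :=
  let: @DCell i s u h := c in DEdge (is_inner_child false h).
Definition pre_rbot (c : pre_cell) : pre_edge :=
  let: @DCell i s u h := c in DEdge (is_inner_child true h).

Definition pre_core : complex := {|
  vertex := pre_vertex;
  edge := pre_edge;
  cell := pre_cell;
  initial := pre_initial;
  terminal := pre_terminal;
  top := pre_top;
  lbot := pre_lbot;
  rbot := pre_rbot;
  distinguished := PEdge |}.

Inductive core_glue : pre_edge -> pre_edge -> Prop :=
  | GlueLeaf i j u v (hu : is_node (side_tree (D i) true) u)
      (hv : is_node (side_tree (D i) false) v) :
      (j < nleaves (D i))%N ->
      u = nth [::] (leaves (tree_plus (D i))) j ->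
      v = nth [::] (leaves (tree_minus (D i))) j ->
      core_glue (DEdge hu) (DEdge hv)
  | GlueRoot i s (h : is_node (side_tree (D i) s) [::]) :
      core_glue PEdge (DEdge h).

Definition core_of_diagrams : complex := @folded pre_core core_glue.

End Core.

(* The core L(H) built from a generating set S of H. *)
Definition core (R : realType) (S : set (R -> R)) : complex :=
  core_of_diagrams (fun D : reduced_pairs S => val D).

(* Main.v *)
Require Import Defs.
From mathcomp Require Import all_boot all_order all_algebra.
From mathcomp Require Import all_classical all_reals all_analysis.
From mathcomp Require Import ring lra zify.

(** The core is read as an automaton: a binary word labels at most one path that
    starts at the distinguished edge p and goes from the top edge of a cell to
    its left or right bottom edge. Two facts link it with the group.

    The first bounds what folding can identify. Call words u and v locally
    equivalent if for all sufficiently long w some element of H maps [uw]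
    linearly onto [vw]. This relation contains the identifications made by the
    generating diagrams and is closed under both foldings, so words leading to
    the same edge of the core are locally equivalent
    ([fold_edge_locally_equiv], [walk_locally_equiv]). In particular an edge
    has well-defined H-orbits of end points, and a vertex of the core has a
    well-defined H-orbit of points of [0, 1] ([vertex_class_orbit]); those of
    the initial and terminal vertices are {0} and {1}.

    The second says that the core accepts H. Every element f of H has
    pieces [u] -> [v], linear and covering [0, 1], such that u and v lead
    from p to the same edge ([subgroup_covered]). This holds for the generators
    because their diagrams map to the core, and it passes to inverses and, by
    determinism of the automaton, to products. It relies on each generator
    having a reduced pair of trees ([thompsonF_reduced_pair]).

    If every edge is a top edge, then all words are readable, and every dyadic
    fraction .u1, being the right end of [u0], belongs to the orbit of an inner
    vertex; with a single inner vertex there is a single orbit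
    ([transitive_of_core]).

    Conversely let H be transitive. If an edge E read by w were not a top edge,
    an element of H taking .z1 to .w1 would map [z] linearly onto [w], with z
    and w reading the same edge, as the core reads no proper extension of w.
    Thus all words z would read E, which is absurd ([top_of_transitive]). So all
    words are readable, and a word u0 has a terminal vertex that depends only on
    the point .u1 and, since H is accepted by the core, only on the orbit
    of this point. All inner vertices arise in this way ([inner_terminal]), so
    they coincide ([inner_unique]). *)

Set Implicit Arguments.
Unset Strict Implicit.
Unset Printing Implicit Defensive.

Import Order.TTheory GRing.Theory Num.Theory.

Local Open Scope classical_set_scope.
Local Open Scope ring_scope.

(** * Points of standard dyadic intervals *)
Section Words.
Variable R : realType.
Implicit Types (u v w : word) (f g : R -> R) (a b t x y : R).

(** The affine parametrization of [u] by [0, 1]; its values at 0 and 1 are the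
    ends of [u], and its value at 1/2 is the dyadic fraction .u1. Appending
    words becomes composition of these maps. *)
Definition wpoint u t : R := wval R u + 2 ^- size u * t.

Lemma wpoint_nil t : wpoint [::] t = t.
Proof. by rewrite /wpoint /= expr0 invr1 mul1r add0r. Qed.

Lemma wpoint_cons (b : bool) u t : wpoint (b :: u) t = (b%:R + wpoint u t) / 2.
Proof. by rewrite /wpoint /= exprS invfM; ring. Qed.

Lemma wpoint_cat u v t : wpoint (u ++ v) t = wpoint u (wpoint v t).
Proof.
elim: u => [|b u IHu]; first by rewrite wpoint_nil.
by rewrite cat_cons !wpoint_cons IHu.
Qed.

Lemma wpoint_rcons u (b : bool) t :
  wpoint (rcons u b) t = wpoint u ((b%:R + t) / 2).
Proof. by rewrite -cats1 wpoint_cat wpoint_cons wpoint_nil. Qed.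

Lemma invexp2_gt0 n : 0 < 2 ^- n :> R.
Proof. by rewrite invr_gt0 exprn_gt0. Qed.

Lemma ltr_wpoint u : {mono wpoint u : x y / x < y}.
Proof. by move=> x y; rewrite /wpoint ltrD2l ltr_pM2l ?invexp2_gt0. Qed.

Lemma ler_wpoint u : {mono wpoint u : x y / x <= y}.
Proof. by move=> x y; rewrite /wpoint lerD2l ler_pM2l ?invexp2_gt0. Qed.

Lemma wpoint0_ge0 u : 0 <= wpoint u 0.
Proof.
elim: u => [|b u IHu]; rewrite ?wpoint_nil ?wpoint_cons //.
by case: b => /=; lra.
Qed.

Lemma wpoint1_le1 u : wpoint u 1 <= 1.
Proof.
elim: u => [|b u IHu]; rewrite ?wpoint_nil ?wpoint_cons //.
by case: b => /=; lra.
Qed.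

Lemma wpoint_bounds u t : 0 <= t <= 1 -> 0 <= wpoint u t <= 1.
Proof.
case/andP=> t0 t1; apply/andP; split.
  by apply: le_trans (wpoint0_ge0 u) _; rewrite ler_wpoint.
by apply: le_trans (wpoint1_le1 u); rewrite ler_wpoint.
Qed.

Lemma wpoint_inside u t : 0 < t < 1 -> 0 < wpoint u t < 1.
Proof.
case/andP=> t0 t1; apply/andP; split.
  by apply: le_lt_trans (wpoint0_ge0 u) _; rewrite ltr_wpoint.
by apply: lt_le_trans (wpoint1_le1 u); rewrite ltr_wpoint.
Qed.

Lemma wpoint_zeros n : wpoint (nseq n false) 0 = 0.
Proof.
by elim: n => [|n IHn]; rewrite ?wpoint_nil //= wpoint_cons IHn /=; lra.
Qed.

Lemma wpoint_ones n : wpoint (nseq n true) 1 = 1.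
Proof.
by elim: n => [|n IHn]; rewrite ?wpoint_nil //= wpoint_cons IHn /=; lra.
Qed.


Lemma half_inside : 0 < (2^-1 : R) < 1.
Proof. by lra. Qed.

(** A dyadic fraction in (0, 1) has a unique finite expansion ending in 1. *)
Lemma wpoint_half_inj : injective (wpoint^~ 2^-1).
Proof.
elim=> [|b u IHu] [|c v] //=; rewrite ?wpoint_nil ?wpoint_cons.
- by have := wpoint_inside v half_inside; case: c => /= *; exfalso; lra.
- by have := wpoint_inside u half_inside; case: b => /= *; exfalso; lra.
have := wpoint_inside u half_inside; have := wpoint_inside v half_inside.
case: b; case: c => /= hv hu E; try by exfalso; lra.
  by congr (_ :: _); apply: IHu => /=; lra.
by congr (_ :: _); apply: IHu => /=; lra.
Qed.

Lemma wval_grid n e : (e < 2 ^ n)%N ->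
  exists2 v, size v = n & wval R v = e%:R / 2 ^+ n.
Proof.
elim: n e => [|n IHn] e.
  by rewrite expn0 ltnS leqn0 => /eqP ->; exists [::]; rewrite ?mul0r.
rewrite expnS mul2n -addnn => elt; case: (ltnP e (2 ^ n)) => he.
  have [v vn vE] := IHn _ he; exists (false :: v); first by rewrite /= vn.
  by rewrite /= vE exprS invfM; ring.
have [|v vn vE] := IHn (e - 2 ^ n)%N; first by rewrite ltn_subLR.
exists (true :: v); first by rewrite /= vn.
rewrite /= vE natrB // natrX exprS invfM.
have h : 2 ^+ n != 0 :> R by rewrite expf_neq0.
by field; rewrite h.
Qed.

Lemma dyadic01_half u : dyadic01 (wpoint u 2^-1).
Proof.
split; first exact/wpoint_inside/half_inside.
elim: u => [|b u [a [k uE]]].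
  by exists 1, 1%N; rewrite wpoint_nil expr1 mul1r.
exists (b%:Z * 2 ^+ k + a), k.+1; rewrite wpoint_cons uE exprS invfM.
rewrite rmorphD rmorphM rmorphXn /= -pmulrn.
have h : 2 ^+ k != 0 :> R by rewrite expf_neq0.
by field; rewrite h.
Qed.

(** The first digit tells on which side of 1/2 the fraction lies, and the
    recursion on the rescaled half stops once the fraction is 1/2. *)
Lemma wpoint_half_nat k e : (0 < e < 2 ^ k)%N ->
  exists u, wpoint u 2^-1 = e%:R / 2 ^+ k.
Proof.
elim: k e => [|k IHk] e; first by rewrite expn0 ltnS leqn0; case: e.
have h : 2 ^+ k != 0 :> R by rewrite expf_neq0.
rewrite expnS mul2n -addnn exprS invfM => /andP[e0 elt].
case: (ltngtP e (2 ^ k)) => he.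
- have [|u uE] := IHk e; first by rewrite e0.
  by exists (false :: u); rewrite wpoint_cons uE /=; field; rewrite h.
- have [|u uE] := IHk (e - 2 ^ k)%N.
    by rewrite subn_gt0 he ltn_subLR // ltnW.
  exists (true :: u); rewrite wpoint_cons uE natrB ?(ltnW he) // natrX /=.
  by field; rewrite h.
- by exists [::]; rewrite wpoint_nil he natrX; field; rewrite h.
Qed.

Lemma dyadic01_wpoint x : dyadic01 x -> exists u, x = wpoint u 2^-1.
Proof.
case=> /andP[x0 x1] [a [k xE]].
have k0 : 0 < 2 ^+ k :> R by rewrite exprn_gt0.
have aE : a%:~R = x * 2 ^+ k by rewrite xE divfK // gt_eqF.
case: a aE {xE} => a aE; last first.
  have: (Negz a)%:~R < 0 :> R by rewrite ltrz0.
  by rewrite aE pmulr_llt0 // ltNge (ltW x0).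
have [|u uE] := @wpoint_half_nat k a.
  rewrite -(ltr_nat R) -(ltr_nat R a) natrX (aE : a%:R = _) mulr_gt0 //=.
  by rewrite gtr_pMl.
by exists u; rewrite uE (aE : a%:R = _) mulfK // gt_eqF.
Qed.

(** The map [u] -> [v] is stated through the two parametrizations, so that
    composition, inversion and restriction to subintervals need no
    computation with slopes. *)
Definition linear_on f u v :=
  forall t, 0 <= t <= 1 -> f (wpoint u t) = wpoint v t.

Lemma linear_onP f u v :
  (forall x, winterval u x ->
     f x = wval R v + (2 ^- size v / 2 ^- size u) * (x - wval R u)) <->
  linear_on f u v.
Proof.
have h n : 2 ^- n != 0 :> R by rewrite gt_eqF ?invexp2_gt0.
split=> [fuv t /andP[t0 t1] | fuv x].
  rewrite fuv /wpoint; first by field; rewrite !expf_neq0.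
  rewrite /winterval /= in_itv /= lerDl lerD2l pmulr_rge0 ?invexp2_gt0 //.
  by rewrite t0 ger_pMr ?invexp2_gt0.
rewrite /winterval /= in_itv /= => /andP[x0 x1].
pose t := (x - wval R u) / 2 ^- size u.
have xE : x = wpoint u t by rewrite /wpoint mulrC divfK // addrC subrK.
rewrite [in LHS]xE fuv /wpoint /t; first by field; rewrite !expf_neq0.
rewrite ler_pdivrMr ?invexp2_gt0 // mul1r lerBlDl x1 andbT.
by rewrite divr_ge0 ?subr_ge0 // ltW ?invexp2_gt0.
Qed.

Lemma linear_on_cat f u v w :
  linear_on f u v -> linear_on f (u ++ w) (v ++ w).
Proof. by move=> fuv t /(wpoint_bounds w) h; rewrite !wpoint_cat fuv. Qed.

Lemma linear_on_comp f g u v w :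
  linear_on f u v -> linear_on g v w -> linear_on (g \o f) u w.
Proof. by move=> fuv gvw t h; rewrite /= fuv // gvw. Qed.

Lemma linear_on_cancel f g u v :
  cancel f g -> linear_on f u v -> linear_on g v u.
Proof. by move=> fK fuv t h; rewrite -fuv // fK. Qed.

Lemma linear_on_merge f u v :
    linear_on f (rcons u false) (rcons v false) ->
    linear_on f (rcons u true) (rcons v true) ->
  linear_on f u v.
Proof.
move=> f0 f1 t /andP[t0 t1]; case: (lerP t 2^-1) => ht.
  have := f0 (t * 2); rewrite !wpoint_rcons add0r mulfK ?pnatr_eq0 //.
  by apply; lra.
have E : (true%:R + (t * 2 - 1)) / 2 = t by rewrite /=; lra.
by have := f1 (t * 2 - 1); rewrite !wpoint_rcons E; apply; lra.
Qed.

(** Consecutive intervals from a to b. The leaves of a tree, from left to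
    right, satisfy this relation from 0 to 1, and so do their images under a
    homeomorphism that is linear on them. *)
Fixpoint tiles a (s : seq word) b : Prop :=
  if s is v :: s' then wpoint v 0 = a /\ tiles (wpoint v 1) s' b else a = b.

Lemma tiles_cat a s1 s2 b :
  tiles a (s1 ++ s2) b <-> exists2 c, tiles a s1 c & tiles c s2 b.
Proof.
elim: s1 a => [|v s1 IHs] a /=; first by split=> [|[_ <-]//]; exists a.
split=> [[ha /IHs[c h1 h2]]|[c [ha h1] h2]]; first by exists c.
by split=> //; apply/IHs; exists c.
Qed.

Lemma tiles_head a s b : tiles a s b -> head b [seq wpoint v 0 | v <- s] = a.
Proof. by case: s => [|v s] /= => [->|[]]. Qed.

Lemma tiles_map_cat u a s b : tiles a s b ->
  tiles (wpoint u a) [seq u ++ v | v <- s] (wpoint u b).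
Proof.
elim: s a => [|v s IHs] a /= => [->//|[<- h]].
by rewrite !wpoint_cat; split=> //; apply: IHs.
Qed.

Lemma tiles_leaves (T : tree) : tiles 0 (leaves T) 1.
Proof.
elim: T => [|l IHl r IHr] /=; first by rewrite !wpoint_nil.
apply/tiles_cat; exists 2^-1.
  have := tiles_map_cat [:: false] IHl.
  by rewrite !wpoint_cons !wpoint_nil /= addr0 mul0r add0r mul1r.
have := tiles_map_cat [:: true] IHr.
by rewrite !wpoint_cons !wpoint_nil /= addr0 mul1r divff ?pnatr_eq0.
Qed.

End Words.

(** * Binary trees as tilings of the unit interval *)
Section TilingTrees.
Variable R : realType.
Implicit Types (u v w : word) (s r : seq word) (a b x y : R).

Lemma wpoint_lt01 u : wpoint u 0 < wpoint u 1 :> R.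
Proof. by rewrite ltr_wpoint. Qed.

Lemma tiles_mem a s b v : tiles a s b -> v \in s -> a <= wpoint v 0.
Proof.
elim: s a => //= w s IHs a [<- h]; rewrite inE => /predU1P[->//|/(IHs _ h)].
exact/le_trans/ltW/wpoint_lt01.
Qed.

(** The empty word occupies the whole unit interval and leaves no room for
    another tile. *)
Lemma tiles_trivial a s : 0 <= a -> tiles a s 1 -> [::] \in s -> s = [:: [::]].
Proof.
case: s => // v s a0 /= [_ h]; rewrite inE => /predU1P[vE|vs].
  move: h; rewrite -vE wpoint_nil; case: s => //= w s [w1 _].
  have := wpoint1_le1 R w; have := wpoint_lt01 w.
  by rewrite w1 => *; exfalso; lra.
have := tiles_mem h vs; rewrite wpoint_nil leNgt.
by rewrite (le_lt_trans (wpoint0_ge0 R v)) // wpoint_lt01.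
Qed.

Lemma tiles_right_half a s : 2^-1 <= a -> [::] \notin s -> tiles a s 1 ->
  exists2 r, s = [seq true :: v | v <- r] & tiles (a * 2 - 1) r 1.
Proof.
elim: s a => [|[|b v] s IHs] a ha //=.
  by move=> _ ->; exists [::] => //=; lra.
rewrite inE /= => ns [va h].
have bE : b = true.
  case: b va {h} => // va; exfalso; move: va; rewrite wpoint_cons /= => va.
  by have := wpoint1_le1 R v; have := wpoint_lt01 v; lra.
rewrite bE in va h *; move: va h; rewrite !wpoint_cons /= => va h.
have v01 := wpoint_lt01 v.
have [|r -> hr] := IHs _ _ ns h; first by have := wpoint0_ge0 R v; lra.
exists (v :: r) => //=; split; first by lra.
by move: hr; congr tiles; lra.
Qed.

(** No standard dyadic interval other than [0, 1] has 1/2 in its interior, so a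
    tiling by proper subintervals splits at 1/2, and each part rescales to a
    tiling of its own; this is the recursive structure of a tree. *)
Lemma tiles_halves a s : a <= 2^-1 -> [::] \notin s -> tiles a s 1 ->
  exists l r, [/\ s = [seq false :: v | v <- l] ++ [seq true :: v | v <- r],
                  tiles (a * 2) l 1 & tiles (0 : R) r 1].
Proof.
elim: s a => [|v s IHs] a ha ns h; first by exfalso; move: h => /=; lra.
case: (ltrP a 2^-1) => ha'; last first.
  have [r -> hr] := tiles_right_half ha' ns h.
  exists [::], r; split=> //=; first by lra.
  by move: hr; congr tiles; lra.
case: v ns h => [|b v]; first by rewrite inE.
rewrite inE /= => ns [va h].
have bE : b = false.
  case: b va {h} => // va; exfalso; move: va; rewrite wpoint_cons /= => va.
  by have := wpoint0_ge0 R v; lra.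
rewrite bE in va h *; move: va h; rewrite !wpoint_cons /= => va h.
have [|l [r [-> hl hr]]] := IHs _ _ ns h; first by have := wpoint1_le1 R v; lra.
exists (v :: l), r; split=> //=; split; first by lra.
by move: hl; congr tiles; lra.
Qed.

(** Induction on a bound for the lengths of the words, as each halving strips
    the first letter. *)
Lemma tree_of_tiles s : tiles (0 : R) s 1 -> exists T, leaves T = s.
Proof.
have [n] : exists n, all (fun v => size v <= n)%N s.
  elim: s => [|v s [n /allP ns]]; first by exists 0%N.
  exists (maxn (size v) n); rewrite /= leq_maxl.
  by apply/allP=> w /ns /leq_trans; apply; rewrite leq_maxr.
elim: n s => [|n IHn] s /allP sn h; case: (boolP ([::] \in s)) => ns.
- by exists Leaf; rewrite (tiles_trivial _ h ns).
- case: s ns h sn => [|v s] ns h sn; first by exfalso; move: h => /=; lra.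
  have := sn v; rewrite inE eqxx leqn0 => /(_ isT)/nilP vE.
  by rewrite vE inE eqxx in ns.
- by exists Leaf; rewrite (tiles_trivial _ h ns).
have [|l [r [sE hl hr]]] := tiles_halves _ ns h; first by lra.
rewrite mul0r in hl.
have [|//|L LE] := IHn l.
  apply/allP=> v vl; apply: (sn (false :: v)).
  by rewrite sE mem_cat map_f.
have [|//|Q QE] := IHn r.
  apply/allP=> v vl; apply: (sn (true :: v)).
  by rewrite sE mem_cat (map_f (cons true)) ?orbT.
by exists (Node L Q); rewrite /= LE QE sE.
Qed.


Lemma tiles_merge a s1 u s2 b :
  tiles a (s1 ++ rcons u false :: rcons u true :: s2) b ->
  tiles a (s1 ++ u :: s2) b.
Proof.
case/tiles_cat=> c h1 /= [hc [_ h2]]; apply/tiles_cat; exists c => //=.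
move: hc h2; rewrite !wpoint_rcons add0r mul0r => ->.
by rewrite /= divff ?pnatr_eq0.
Qed.

Lemma mem_leaves_node T u : u \in leaves T -> is_node T u.
Proof.
elim: T u => [|l IHl r IHr] u /=; first by rewrite inE => /eqP->.
by rewrite mem_cat => /orP[]/mapP[v vT ->] /=; [apply: IHl|apply: IHr].
Qed.

End TilingTrees.

(** * From a tiling of the domain to a reduced pair of trees *)
Section Pairs.
Variable R : realType.
Implicit Types (f : R -> R) (u v : word) (D : tree_pair).

(** Lists of pairs of leaves are easier to cut and merge than indices. *)
Lemma representsP D f : represents D f <->
  {in zip (leaves (tree_plus D)) (leaves (tree_minus D)),
    forall p, linear_on f p.1 p.2}.
Proof.
have sz := size_leaves D; split=> [h p /(nthP ([::], [::]))[i]|h i ilt u v].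
  rewrite size_zip -sz minnn => ilt <-; rewrite nth_zip //=.
  exact/linear_onP/h.
apply/linear_onP/(h (u, v))/(nthP ([::], [::])).
by exists i; rewrite ?nth_zip // size_zip -sz minnn.
Qed.

Lemma caret_split T i : caret T i -> exists s1 u s2,
  leaves T = s1 ++ rcons u false :: rcons u true :: s2 /\ size s1 = i.
Proof.
case=> ilt [u [u0 u1]].
exists (take i (leaves T)), u, (drop i.+2 (leaves T)); split.
  by rewrite -u0 -u1 -!drop_nth ?cat_take_drop // ltnW.
by rewrite size_takel // ltnW // ltnW.
Qed.

(** Removing a common caret preserves the represented map, because the two
    linear pieces on the halves of a leaf fit together. The shortened lists of
    leaves still tile the unit interval, which produces the smaller trees. *)
Lemma reduced_pair_exists D f : represents D f ->
  exists2 D', reduced D' & represents D' f.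
Proof.
have [n] := ubnP (nleaves D); elim: n D => // n IHn D Dn /representsP Df.
have [Dr|] := pselect (reduced D); first by exists D => //; apply/representsP.
move=> /existsNP[i] /contrapT[/caret_split[s1 [u [s2 [uE si]]]]].
move=> /caret_split[r1 [v [r2 [vE ri]]]].
have [|P PE] := @tree_of_tiles R (s1 ++ u :: s2).
  by apply: tiles_merge; rewrite -uE; apply: tiles_leaves.
have [|Q QE] := @tree_of_tiles R (r1 ++ v :: r2).
  by apply: tiles_merge; rewrite -vE; apply: tiles_leaves.
have sr : size s1 = size r1 by rewrite si ri.
have PQ : size (leaves P) = size (leaves Q).
  by have := size_leaves D; rewrite uE vE PE QE !size_cat /= sr; lia.
apply: (IHn (TreePair PQ)).
  by move: Dn; rewrite /nleaves uE /= PE !size_cat /=; lia.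
apply/representsP => p; move: Df; rewrite uE vE /= PE QE !zip_cat //= => Df.
rewrite mem_cat inE => /or3P[h|/eqP->|h].
- by apply: Df; rewrite mem_cat h.
- apply: linear_on_merge.
    by apply: (Df (_, _)); rewrite mem_cat inE eqxx orbT.
  by apply: (Df (_, _)); rewrite mem_cat !inE eqxx !orbT.
- by apply: Df; rewrite mem_cat !inE h !orbT.
Qed.

Lemma tiles_image f a s b : tiles a s b ->
    (forall u, u \in s -> exists v, linear_on f u v) ->
  exists r, [/\ size r = size s, tiles (f a) r (f b) &
                {in zip s r, forall p, linear_on f p.1 p.2}].
Proof.
elim: s a => [|u s IHs] a /=; first by move=> -> _; exists [::].
move=> [<- /IHs h] su; have [|r [rs hr fr]] := h.
  by move=> v vs; apply: su; rewrite inE vs orbT.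
have [|v fuv] := su u; first by rewrite inE eqxx.
exists (v :: r); split=> /=; first by rewrite rs.
  by rewrite -!fuv ?lexx ?ler01.
by move=> p; rewrite inE => /predU1P[->|/fr].
Qed.

(** The image tree comes for free: the images of consecutive intervals are
    consecutive, hence they are the leaves of some tree. *)
Lemma pair_of_domain_tree f T : f 0 = 0 -> f 1 = 1 ->
    (forall u, u \in leaves T -> exists v, linear_on f u v) ->
  exists D, represents D f.
Proof.
move=> f0 f1 Tf; have [r [rs]] := tiles_image (tiles_leaves R T) Tf.
rewrite f0 f1 => /tree_of_tiles[T' T'E] fr.
have TT' : size (leaves T) = size (leaves T') by rewrite T'E.
by exists (TreePair TT'); apply/representsP => /=; rewrite T'E.
Qed.

Fixpoint full_tree n :=
  if n is n'.+1 then Node (full_tree n') (full_tree n') else Leaf.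

Lemma size_full_tree n u : u \in leaves (full_tree n) -> size u = n.
Proof.
elim: n u => [|n IHn] u /=; first by rewrite inE => /eqP->.
by rewrite mem_cat => /orP[]/mapP[v /IHn <- ->].
Qed.

(** The full tree of depth N, with a further tree hung on each of its leaves. *)
Lemma graft_trees (P : word -> Prop) N :
    (forall u, size u = N ->
       exists T, forall t, t \in leaves T -> P (u ++ t)) ->
  exists T, forall t, t \in leaves T -> P t.
Proof.
move=> PN; suff h n u : (size u + n = N)%N ->
    exists T, forall t, t \in leaves T -> P (u ++ t) by apply: (h N [::]).
elim: n u => [|n IHn] u; first by rewrite addn0; apply: PN.
move=> un.
have [|l hl] := IHn (rcons u false); first by rewrite size_rcons; lia.
have [|r hr] := IHn (rcons u true); first by rewrite size_rcons; lia.
exists (Node l r) => t /=; rewrite mem_cat => /orP[]/mapP[w wT ->].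
  by rewrite -cat_rcons; apply: hl.
by rewrite -cat_rcons; apply: hr.
Qed.

End Pairs.

(** * Every element of Thompson's group has a reduced pair of trees *)
Section Elements.
Variable R : realType.
Implicit Types (f : R -> R) (u v : word) (x y : R).

Lemma wval_nat u : exists e : nat, wval R u = e%:R / 2 ^+ size u.
Proof.
elim: u => [|b u [e IHu]] /=; first by exists 0%N; rewrite mul0r.
exists (b * 2 ^ size u + e)%N; rewrite IHu natrD natrM natrX exprS.
have h : 2 ^+ size u != 0 :> R by rewrite expf_neq0.
by field; rewrite h.
Qed.

Lemma dyadicD x y : dyadic x -> dyadic y -> dyadic (x + y).
Proof.
case=> a [k ->] [b [m ->]]; exists (a * 2 ^+ m + b * 2 ^+ k), (k + m)%N.
rewrite rmorphD !rmorphM !rmorphXn /= exprD.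
have h n : 2 ^+ n != 0 :> R by rewrite expf_neq0.
by field; rewrite !h.
Qed.

Lemma expz2 (k : int) : exists p q : nat, (2 : R) ^ k = 2 ^+ p / 2 ^+ q.
Proof.
case: k => k; first by exists k, 0%N; rewrite expr0 invr1 mulr1.
by exists 0%N, k.+1; rewrite expr0 mul1r NegzE -exprnN.
Qed.

(** If f maps [u] affinely from the point c / 2^P with slope 2^p / 2^q, then
    after P + p further bisections the image of each piece has length
    2^-n with n >= P, and it starts at a multiple of 2^-n, so it is a standard
    dyadic interval. *)
Lemma affine_image_words f u (p q P : nat) (c : int) :
    (forall x, 0 <= x <= 1 -> 0 <= f x <= 1) ->
    (forall t, 0 <= t <= 1 -> f (wpoint u t) =
       c%:~R / 2 ^+ P + 2 ^+ p / 2 ^+ q * (2 ^- size u * t)) ->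
  forall w, size w = (P + p)%N -> exists v, linear_on f (u ++ w) v.
Proof.
move=> f01 fu w ws; have [d dE] := wval_nat w.
have h n : 2 ^+ n != 0 :> R by rewrite expf_neq0.
(* The image of [uw] is the interval from e / 2^n to (e + 1) / 2^n. *)
pose n := (size u + P + q)%N; pose e : int := c * 2 ^+ (size u + q) + d.
have fE t : 0 <= t <= 1 -> f (wpoint (u ++ w) t) = (e%:~R + t) / 2 ^+ n.
  move=> /[dup] t01 /(wpoint_bounds w) ht.
  rewrite wpoint_cat fu // /wpoint dE ws.
  rewrite /n /e rmorphD rmorphM rmorphXn /= -!pmulrn !exprD.
  by field; rewrite !h.
have n0 : 0 < 2 ^+ n :> R by rewrite exprn_gt0.
have e0 : 0 <= e%:~R :> R.
  have /(wpoint_bounds (u ++ w))/f01 : 0 <= (0 : R) <= 1 by rewrite lexx ler01.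
  rewrite fE ?lexx ?ler01 // addr0 => /andP[+ _].
  by rewrite pmulr_lge0 // invr_gt0.
have e1 : e%:~R + 1 <= 2 ^+ n :> R.
  have /(wpoint_bounds (u ++ w))/f01 : 0 <= (1 : R) <= 1 by rewrite lexx ler01.
  rewrite fE ?lexx ?ler01 // => /andP[_].
  by rewrite ler_pdivrMr // mul1r.
case: e e0 e1 fE => e; last by rewrite ler0z.
move=> _ e1 fE; have [|v vn vE] := @wval_grid R n e.
  by rewrite -(ler_nat R) natrX -natr1.
exists v => t /fE ->; rewrite /wpoint vE vn -pmulrn mulrDl.
by rewrite [t / _]mulrC.
Qed.

Lemma thompsonF_range f x : thompsonF f -> 0 <= x <= 1 -> 0 <= f x <= 1.
Proof.
by case=> _ [ff _ _] _ _ _ h; have := ff x; rewrite /= !in_itv /=; apply.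
Qed.

Lemma thompsonF0 f : thompsonF f -> f 0 = 0.
Proof.
move=> Ff; have zI : 0 <= (0 : R) <= 1 by rewrite lexx ler01.
have /andP[f0 _] := thompsonF_range Ff zI.
case: Ff => _ [_ _ fs] _ fm _; have [|x] := fs 0; first by rewrite /= in_itv.
rewrite /= in_itv /= => x01 fx.
have [x0|x0] := eqVneq x 0; first by rewrite -{1}x0.
have := fm 0 x; rewrite fx !in_itv /= lexx ler01 x01 lt_neqAle eq_sym x0.
by case/andP: x01 => -> _ /(_ isT isT isT); rewrite ltNge f0.
Qed.

Lemma thompsonF1 f : thompsonF f -> f 1 = 1.
Proof.
move=> Ff; have zI : 0 <= (1 : R) <= 1 by rewrite lexx ler01.
have /andP[_ f1] := thompsonF_range Ff zI.
case: Ff => _ [_ _ fs] _ fm _; have [|x] := fs 1; first by rewrite /= in_itv.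
rewrite /= in_itv /= => x01 fx.
have [x1|x1] := eqVneq x 1; first by rewrite -{1}x1.
have := fm x 1; rewrite fx !in_itv /= lexx ler01 x01 lt_neqAle x1.
by case/andP: x01 => _ -> /(_ isT isT isT); rewrite ltNge f1.
Qed.

Lemma thompsonF_inverse f : thompsonF f -> exists2 g, cancel f g & cancel g f.
Proof.
case=> fout [ff fi fs] _ _ _.
have [|g gK] := @choice _ _ (fun y x => f x = y).
  move=> y; have [yI|yI] := boolP (y \in `[0, 1]); last first.
    by exists y; apply: fout.
  by have [x] := fs _ yI; exists x.
exists g => // x.
have out y : y \in `[0, 1] = (f y \in `[0, 1]).
  by have [/ff//|/[dup] /fout -> /negPf ->] := boolP (y \in _).
have := gK (f x); have [xI|xI] := boolP (x \in `[0, 1]).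
  by apply: fi; rewrite inE //= out gK -out.
have gI : g (f x) \notin `[0, 1] by rewrite out gK -out.
by move=> E; rewrite -(fout _ gI) E fout.
Qed.

(** A power 2^N that is a common denominator of the breakpoints works: no
    breakpoint lies strictly between two consecutive multiples of 2^-N. *)
Lemma thompsonF_affine f : thompsonF f -> exists N, forall j, (j < 2 ^ N)%N ->
  exists k : int, forall t, 0 <= t <= 1 ->
    f ((j%:R + t) / 2 ^+ N) = f (j%:R / 2 ^+ N) + 2 ^ k * (2 ^- N * t).
Proof.
case=> _ _ _ _ [s s01 sf].
have h n : 2 ^+ n != 0 :> R by rewrite expf_neq0.
have h0 n : 0 < 2 ^+ n :> R by rewrite exprn_gt0.
have [N sN] : exists N, {in s, forall x, exists a : int, x = a%:~R / 2 ^+ N}.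
  elim: s s01 {sf} => [|y s IHs] s01; first by exists 0%N.
  have [|N IHN] := IHs; first by move=> x xs; apply: s01; rewrite inE xs orbT.
  have [_ [a [k yE]]] := s01 y (mem_head _ _).
  exists (N + k)%N => x; rewrite inE => /predU1P[->|/IHN[b ->]].
    exists (a * 2 ^+ N); rewrite yE rmorphM rmorphXn /= exprD.
    by field; rewrite !h.
  exists (b * 2 ^+ k); rewrite rmorphM rmorphXn /= exprD.
  by field; rewrite !h.
exists N => j jN.
have [||||k kE] := sf (j%:R / 2 ^+ N) ((j%:R + 1) / 2 ^+ N).
- by rewrite divr_ge0 // ltW.
- by rewrite ltr_pM2r ?invr_gt0 // ltrDl.
- by rewrite ler_pdivrMr // mul1r natr1 -natrX ler_nat.
- move=> x /sN[a ->]; rewrite !ltr_pM2r ?invr_gt0 // natr1 !pmulrn !ltr_int.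
  lia.
exists k => t /andP[t0 t1]; rewrite kE; first by field; rewrite !h.
by rewrite !ler_pM2r ?invr_gt0 // lerDl lerD2l t0.
Qed.

(** On each interval of length 2^-N the map is affine, and its value at the left
    end is dyadic since all slopes and lengths to its left are powers of 2. A
    finer subdivision then has standard dyadic images. *)
Lemma thompsonF_pair f : thompsonF f -> exists D, represents D f.
Proof.
move=> Ff; have [N fN] := thompsonF_affine Ff.
have h n : 2 ^+ n != 0 :> R by rewrite expf_neq0.
have fdy j : (j <= 2 ^ N)%N -> dyadic (f (j%:R / 2 ^+ N)).
  elim: j => [_|j IHj jN]; first by exists 0, 0%N; rewrite !mul0r thompsonF0.
  have [k /(_ 1)] := fN _ jN; rewrite natr1 mulr1 lexx ler01 => /(_ isT) ->.
  apply/(dyadicD (IHj (ltnW jN))).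
  have [p [q ->]] := expz2 k; exists (2 ^+ p), (q + N)%N.
  by rewrite rmorphXn /= exprD invfM mulrA.
suff [T] : exists T, forall u, u \in leaves T -> exists v, linear_on f u v.
  exact: (pair_of_domain_tree (thompsonF0 Ff) (thompsonF1 Ff)).
apply: (graft_trees (P := fun w => exists v, linear_on f w v) (N := N)) => u uN.
have [e uE] := wval_nat u; rewrite uN in uE.
have eN : (e < 2 ^ N)%N.
  have := wpoint1_le1 R u.
  rewrite /wpoint mulr1 uE uN -[X in _ + X]mul1r -mulrDl.
  rewrite ler_pdivrMr ?exprn_gt0 // mul1r natr1.
  by rewrite -natrX ler_nat.
have [k fk] := fN _ eN; have [c [P cE]] := fdy _ (ltnW eN).
have [p [q kE]] := expz2 k; exists (full_tree (P + p)) => t /size_full_tree.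
apply: (affine_image_words (q := q) (c := c) (fun x => thompsonF_range Ff)).
move=> t' /fk.
rewrite cE kE uN => <-.
by congr f; rewrite /wpoint uE uN; field; rewrite h.
Qed.

Lemma thompsonF_reduced_pair f : thompsonF f ->
  exists2 D, reduced D & represents D f.
Proof. by move=> /thompsonF_pair[D /reduced_pair_exists]. Qed.

End Elements.

(** * Reading words in a directed complex *)
Section Walks.
Variable K : complex.
Implicit Types (e : edge K) (c : cell K) (u v w : word).

Definition lower (b : bool) c : edge K := if b then rbot c else lbot c.

(** From the top edge of a cell the letter 0 leads to the left bottom edge and
    the letter 1 to the right one: a complex is read as an automaton whose
    states are the edges. *)
Fixpoint walk e w e' : Prop :=
  if w is b :: w' then exists2 c, top c = e & walk (lower b c) w' e'
  else e = e'.

Lemma walk_cat e u v e' :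
  walk e (u ++ v) e' <-> exists2 m, walk e u m & walk m v e'.
Proof.
elim: u e => [|b u IHu] e /=; first by split=> [h|[m ->]//]; exists e.
split=> [[c ce /IHu[m um mv]]|[m [c ce um] mv]].
  by exists m => //; exists c.
by exists c => //; apply/IHu; exists m.
Qed.

Lemma walk_rcons e u b e' :
  walk e (rcons u b) e' <-> exists2 c, walk e u (top c) & lower b c = e'.
Proof.
rewrite -cats1; split=> [/walk_cat[m um /= [c cm <-]]|[c uc <-]].
  by exists c; rewrite ?cm.
by apply/walk_cat; exists (top c) => //=; exists c.
Qed.

Lemma walk_total e w : every_edge_is_top K -> exists e', walk e w e'.
Proof.
move=> Kt; elim: w e => [|b w IHw] e /=; first by exists e.
have [c ce] := Kt e; have [e' we'] := IHw (lower b c).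
by exists e', c.
Qed.

Definition deterministic : Prop :=
  forall b c c', top c = top c' -> lower b c = lower b c'.

Lemma walk_fun e w e1 e2 :
  deterministic -> walk e w e1 -> walk e w e2 -> e1 = e2.
Proof.
move=> Kd; elim: w e => [|b w IHw] e /=; first by move=> <- <-.
by move=> [c ce h1] [c' c'e]; rewrite -(Kd b c c') ?ce //; apply: IHw.
Qed.

End Walks.

(** * Ends of the nodes of a tree *)
Section LeafCounting.
Implicit Types (T l r : tree) (u : word).

Lemma first_leaf_nil T : first_leaf T [::] = 0%N.
Proof.
by rewrite /first_leaf; case: (leaves T) => //= u s; rewrite prefix0s.
Qed.

Lemma nleaves_below_nil T : nleaves_below T [::] = size (leaves T).
Proof.
rewrite /nleaves_below -[RHS]count_predT.
by apply: eq_count => u; rewrite prefix0s.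
Qed.

Lemma size_leaves_gt0 T : (0 < size (leaves T))%N.
Proof. by elim: T => //= l IHl r _; rewrite size_cat size_map addn_gt0 IHl. Qed.

Lemma nleaves_below_cons l r b u :
  nleaves_below (Node l r) (b :: u) = nleaves_below (if b then r else l) u.
Proof.
rewrite /nleaves_below /= count_cat !count_map.
by case: b; rewrite /preim /= ?count_pred0 ?addn0.
Qed.

Lemma nleaves_below_gt0 T u : is_node T u -> (0 < nleaves_below T u)%N.
Proof.
elim: T u => [|l IHl r IHr] [|b u] //=.
  by rewrite nleaves_below_nil size_leaves_gt0.
by rewrite nleaves_below_cons; case: b => [/IHr|/IHl].
Qed.

Lemma first_leaf_cons l r b u : is_node (if b then r else l) u ->
  first_leaf (Node l r) (b :: u) =
  ((if b then size (leaves l) else 0) + first_leaf (if b then r else l) u)%N.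
Proof.
move=> /nleaves_below_gt0; rewrite -has_count /first_leaf /= find_cat has_map.
rewrite !find_map size_map.
by case: b; rewrite /preim /= ?has_pred0 // => ->.
Qed.

Lemma last_leaf_right T u : is_inner T u ->
  (first_leaf T (rcons u true) + nleaves_below T (rcons u true) =
   first_leaf T u + nleaves_below T u)%N.
Proof.
elim: T u => [|l IHl r IHr] [|b u] //=.
  move=> _; rewrite first_leaf_cons; last by case: (r).
  rewrite nleaves_below_cons !first_leaf_nil !nleaves_below_nil addn0 add0n.
  by rewrite size_cat !size_map.
move=> hu; have hu' := is_inner_node hu; have hr := is_inner_child true hu.
rewrite !first_leaf_cons // !nleaves_below_cons -!addnA; congr addn.
by case: b hu {hu' hr} => [/IHr|/IHl].
Qed.

Lemma leaf_position T j : (j < size (leaves T))%N ->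
  first_leaf T (nth [::] (leaves T) j) = j /\
  nleaves_below T (nth [::] (leaves T) j) = 1%N.
Proof.
elim: T j => [|l IHl r IHr] j /=; first by case: j.
rewrite size_cat !size_map nth_cat size_map => jlt.
case: ltnP => jl.
  rewrite (nth_map [::]) // nleaves_below_cons.
  by rewrite first_leaf_cons; [apply: IHl|apply/mem_leaves_node/mem_nth].
have jr : (j - size (leaves l) < size (leaves r))%N by lia.
rewrite (nth_map [::]) // nleaves_below_cons.
rewrite first_leaf_cons; last exact/mem_leaves_node/mem_nth.
by have [-> ->] := IHr _ jr; rewrite subnKC.
Qed.

Variable R : realType.

(** The default value 1 of [nth] makes this meaningful for the last vertex of a
    diagram too: it is the right end of the last leaf. *)
Definition leaf_point T j : R := nth 1 [seq wpoint u 0 | u <- leaves T] j.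

Lemma leaf_point0 T : leaf_point T 0 = 0.
Proof. by rewrite /leaf_point nth0; apply: tiles_head (tiles_leaves R T). Qed.

Lemma leaf_point_size T j : (size (leaves T) <= j)%N -> leaf_point T j = 1.
Proof. by move=> h; rewrite /leaf_point nth_default // size_map. Qed.

Lemma leaf_point_left l r j : (j <= size (leaves l))%N ->
  leaf_point (Node l r) j = wpoint [:: false] (leaf_point l j).
Proof.
rewrite leq_eqVlt => /predU1P[->|jl].
  rewrite [leaf_point l _]leaf_point_size // /leaf_point /= map_cat nth_cat.
  rewrite !size_map ltnn subnn nth0.
  have := tiles_head (tiles_map_cat [:: true] (tiles_leaves R r)).
  rewrite !wpoint_cons !wpoint_nil /= addr0 add0r mulr1n divff ?pnatr_eq0 //.
rewrite /leaf_point /= map_cat nth_cat !size_map jl -map_comp.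
by rewrite !(nth_map [::]) //= -wpoint_cat.
Qed.

Lemma leaf_point_right l r j :
  leaf_point (Node l r) (size (leaves l) + j) =
  wpoint [:: true] (leaf_point r j).
Proof.
case: (ltnP j (size (leaves r))) => jr; last first.
  rewrite !leaf_point_size //= ?size_cat ?size_map ?leq_add2l //.
  by rewrite wpoint_cons wpoint_nil /= divff ?pnatr_eq0.
rewrite /leaf_point /= map_cat nth_cat !size_map ltnNge leq_addr addKn /=.
rewrite -map_comp.
by rewrite !(nth_map [::]) //= -wpoint_cat.
Qed.

Lemma last_leaf_le T u :
  (first_leaf T u + nleaves_below T u <= size (leaves T))%N.
Proof.
rewrite /first_leaf /nleaves_below; elim: (leaves T) => //= v s IHs.
case: prefix => /=; first by rewrite add0n add1n ltnS count_size.
by rewrite add0n addSn ltnS.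
Qed.

(** A vertex of a diagram is thus a point of [0, 1], compatibly with the ends
    of all edges of that tree. *)
Lemma node_ends T u : is_node T u ->
  leaf_point T (first_leaf T u) = wpoint u 0 /\
  leaf_point T (first_leaf T u + nleaves_below T u) = wpoint u 1.
Proof.
elim: T u => [|l IHl r IHr] [|b u] //=.
- rewrite first_leaf_nil nleaves_below_nil leaf_point0 leaf_point_size //.
  by rewrite !wpoint_nil.
- rewrite first_leaf_nil nleaves_below_nil leaf_point0 leaf_point_size //.
  by rewrite !wpoint_nil.
move=> hu; rewrite first_leaf_cons // nleaves_below_cons -addnA.
rewrite -cat1s !wpoint_cat; case: b hu => [/IHr|/IHl] [<- <-].
  by rewrite !leaf_point_right.
have h := last_leaf_le l u.
by rewrite !leaf_point_left // (leq_trans _ h) // leq_addr.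
Qed.

(** The two trees of a diagram share their vertices; the two points that a
    vertex receives from them correspond under f. *)
Lemma represents_leaf_point f D j : represents D f -> f 1 = 1 ->
  f (leaf_point (tree_plus D) j) = leaf_point (tree_minus D) j.
Proof.
move=> Df f1; case: (ltnP j (nleaves D)) => jD; last first.
  by rewrite !leaf_point_size -?(size_leaves D).
have := Df j jD; rewrite /= => /linear_onP fj.
rewrite /leaf_point !(nth_map [::]) -?size_leaves //.
by rewrite fj ?lexx ?ler01.
Qed.

End LeafCounting.

(** * Reading words in the core *)
Section Folded.
Variables (I : Type) (D : I -> tree_pair).
Local Notation K := (core_of_diagrams D).

Definition edge_class (e : pre_edge D) : edge K :=
  cls (@fold_edge (pre_core D) (@core_glue I D)) e.
Definition cell_class (c : pre_cell D) : cell K :=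
  cls (@fold_cell (pre_core D) (@core_glue I D)) c.
Definition vertex_class (v : pre_vertex D) : vertex K :=
  cls (@fold_vertex (pre_core D) (@core_glue I D)) v.

Definition pre_lower (b : bool) (c : pre_cell D) : pre_edge D :=
  if b then pre_rbot c else pre_lbot c.

Lemma edge_class_rep (e : edge K) : exists e', e = edge_class e'.
Proof. by exists (rep e); rewrite /edge_class repK. Qed.

Lemma cell_class_rep (c : cell K) : exists c', c = cell_class c'.
Proof. by exists (rep c); rewrite /cell_class repK. Qed.

Lemma vertex_class_rep (v : vertex K) : exists v', v = vertex_class v'.
Proof. by exists (rep v); rewrite /vertex_class repK. Qed.

Lemma top_class c : top (cell_class c) = edge_class (pre_top c).
Proof. exact: folded_top. Qed.

Lemma lower_class b c : lower b (cell_class c) = edge_class (pre_lower b c).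
Proof. by case: b; [apply: folded_rbot|apply: folded_lbot]. Qed.

Lemma initial_class e : initial (edge_class e) = vertex_class (pre_initial e).
Proof. exact: folded_initial. Qed.

Lemma terminal_class e :
  terminal (edge_class e) = vertex_class (pre_terminal e).
Proof. exact: folded_terminal. Qed.

Lemma iota_class : iota_vertex K = vertex_class (PInitial D).
Proof. exact: (initial_class (PEdge D)). Qed.

Lemma tau_class : tau_vertex K = vertex_class (PTerminal D).
Proof. exact: (terminal_class (PEdge D)). Qed.

Lemma edge_classP e e' : edge_class e = edge_class e' <->
  @fold_edge (pre_core D) (@core_glue I D) e e'.
Proof. exact: cls_edgeP. Qed.

(** Folding two cells with a common top edge is determinism of the
    automaton. *)
Lemma core_deterministic : deterministic K.
Proof.
move=> b c c'; have [{}c ->] := cell_class_rep c.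
have [{}c' ->] := cell_class_rep c'; rewrite !top_class !lower_class.
move=> /edge_classP h; apply/edge_classP.
by case: b; [apply: FoldTopR h|apply: FoldTopL h].
Qed.

Lemma terminal_right (c : cell K) : terminal (lower true c) = terminal (top c).
Proof.
have [{}c ->] := cell_class_rep c.
rewrite top_class lower_class !terminal_class.
case: c => i s u hu /=; congr (vertex_class (DVertex _)).
exact/val_inj/last_leaf_right.
Qed.

Lemma walk_ones e n e' : @walk K e (nseq n true) e' -> terminal e' = terminal e.
Proof.
elim: n e => [e ->//|n IHn e [c <- /IHn ->]].
by apply: terminal_right.
Qed.

Lemma root_class i s (h : is_node (side_tree (D i) s) [::]) :
  edge_class (PEdge D) = edge_class (DEdge h).
Proof. by apply/edge_classP/FoldGlue/GlueRoot. Qed.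

Local Notation p := (distinguished K).

(** The path from the root of a tree down to a node is a sequence of cells, and
    both roots of each diagram are glued to p. *)
Lemma walk_node i s u (h : is_node (side_tree (D i) s) u) :
  walk p u (edge_class (DEdge h)).
Proof.
elim/last_ind: u h => [|u b IHu] h; first exact: root_class.
have hu : is_inner (side_tree (D i) s) u.
  elim: u (side_tree _ _) h {IHu} => [|c u IHu] [|l r] //=.
  by apply: IHu.
apply/walk_rcons; exists (cell_class (DCell hu)).
  by rewrite top_class; apply: IHu.
rewrite lower_class.
by congr edge_class; case: b h => h /=; congr DEdge; apply: bool_irrelevance.
Qed.

Lemma walk_leaves i j : (j < nleaves (D i))%N -> exists2 e,
  walk p (nth [::] (leaves (tree_plus (D i))) j) e &
  walk p (nth [::] (leaves (tree_minus (D i))) j) e.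
Proof.
move=> jD; set u := nth _ _ _; set v := nth _ _ _.
have hu : is_node (side_tree (D i) true) u by apply/mem_leaves_node/mem_nth.
have hv : is_node (side_tree (D i) false) v.
  by apply/mem_leaves_node/mem_nth; rewrite -size_leaves.
exists (edge_class (DEdge hu)); first exact: walk_node.
rewrite (_ : edge_class _ = edge_class (DEdge hv)); first exact: walk_node.
by apply/edge_classP/FoldGlue/(GlueLeaf hu hv jD).
Qed.

Lemma edge_reachable (e : edge K) : exists w, walk p w e.
Proof.
have [[|i s u h] ->] := edge_class_rep e; first by exists [::].
by exists u; apply: walk_node.
Qed.

(** A vertex of a diagram other than the first is the terminal vertex of some
    leaf. Letters 1 at the end of the word of that leaf do not change the
    terminal vertex; stripping them exposes a letter 0, for otherwise the
    vertex would be the terminal vertex of p. *)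
Lemma inner_terminal (z : vertex K) : inner_vertex z ->
  exists u e, walk p (rcons u false) e /\ terminal e = z.
Proof.
have [z' ->] := vertex_class_rep z; case: z' => [[[]]|[_ []]|i [[|j] jD] zI].
- by rewrite iota_class.
- by rewrite tau_class.
- have hr : is_node (side_tree (D i) true) [::] by case: (side_tree _ _).
  case: zI => [[]]; rewrite iota_class.
  rewrite -(initial_class (PEdge D)) (root_class hr).
  rewrite initial_class; congr (vertex_class (DVertex _)).
  by apply/val_inj => /=; rewrite first_leaf_nil.
pose u := nth [::] (leaves (tree_plus (D i))) j.
have hu : is_node (side_tree (D i) true) u by apply/mem_leaves_node/mem_nth.
have ze :
    vertex_class (DVertex (Ordinal jD)) = terminal (edge_class (DEdge hu)).
  rewrite terminal_class; congr (vertex_class (DVertex _)); apply/val_inj => /=.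
  by have [|-> ->] := @leaf_position (tree_plus (D i)) j; rewrite ?addn1.
have := walk_node hu; rewrite {}ze in zI *; move: (edge_class _) zI => e.
elim/last_ind: u e {hu} => [|u b IHu] e.
  by move=> [_ tz] pe; case: tz; rewrite /tau_vertex -(pe : p = e).
move=> zI /walk_rcons[c uc ce]; case: b ce => ce; last first.
  by exists u, e; split=> //; apply/walk_rcons; exists c.
by rewrite -ce terminal_right in zI *; apply: IHu.
Qed.

End Folded.

(** * The core determines local equivalence and orbits *)
Section Orbits.
Variables (R : realType) (H : set (R -> R)).
Hypothesis hH : thompson_subgroup H.
Implicit Types (f g h : R -> R) (u v w : word) (x y z : R).

Let HF f : H f -> thompsonF f. Proof. by case: hH => + _ _ _; apply. Qed.
Let Hid : H id. Proof. by case: hH. Qed.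
Let Hcomp f g : H f -> H g -> H (g \o f).
Proof. by move=> Hf Hg; case: hH => _ _ + _; apply. Qed.

Lemma subgroup_inverse f : H f -> exists g, [/\ H g, cancel f g & cancel g f].
Proof.
move=> Hf; have [g fK gK] := thompsonF_inverse (HF Hf).
by exists g; split=> //; case: hH => _ _ _; apply; [apply: Hf|..].
Qed.

Definition same_orbit x y : Prop := exists2 f, H f & f x = y.

Lemma same_orbit_refl x : same_orbit x x.
Proof. by exists id. Qed.

Lemma same_orbit_sym x y : same_orbit x y -> same_orbit y x.
Proof. by case=> f /subgroup_inverse[g [Hg fK _]] <-; exists g. Qed.

Lemma same_orbit_trans y x z :
  same_orbit x y -> same_orbit y z -> same_orbit x z.
Proof. by move=> [f Hf <-] [g Hg <-]; exists (g \o f) => //; apply: Hcomp. Qed.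

Lemma same_orbit_from0 x : same_orbit 0 x -> x = 0.
Proof. by case=> f /HF/thompsonF0 ->. Qed.

Lemma same_orbit_from1 x : same_orbit 1 x -> x = 1.
Proof. by case=> f /HF/thompsonF1 ->. Qed.

(** A relation on words that is closed under both kinds of folding: it passes
    to children and back to parents. The element of H may depend on the
    extension w, which is what allows a parent to be recovered from its two
    children. *)
Definition locally_equiv u v : Prop := exists k, forall w, (k <= size w)%N ->
  exists2 h, H h & linear_on h (u ++ w) (v ++ w).

Lemma locally_equiv_refl u : locally_equiv u u.
Proof. by exists 0%N => w _; exists id. Qed.

Lemma locally_equiv_sym u v : locally_equiv u v -> locally_equiv v u.
Proof.
case=> k kuv; exists k => w /kuv[h /subgroup_inverse[g [Hg hK _]] huv].
by exists g => //; apply: linear_on_cancel huv.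
Qed.

Lemma locally_equiv_trans v u w :
  locally_equiv u v -> locally_equiv v w -> locally_equiv u w.
Proof.
case=> k kuv [m mvw]; exists (maxn k m) => s; rewrite geq_max => /andP[ks ms].
have [f Hf fuv] := kuv s ks; have [g Hg gvw] := mvw s ms.
by exists (g \o f); [apply: Hcomp|apply: linear_on_comp fuv gvw].
Qed.

Lemma locally_equiv_linear h u v : H h -> linear_on h u v -> locally_equiv u v.
Proof.
by move=> Hh huv; exists 0%N => w _; exists h => //; apply: linear_on_cat.
Qed.

Lemma locally_equiv_child b u v :
  locally_equiv u v -> locally_equiv (rcons u b) (rcons v b).
Proof.
by case=> k kuv; exists k => w kw; rewrite !cat_rcons; apply: kuv; apply: leqW.
Qed.

(** The bound grows by one, to make sure that the extension of the parent
    word passes through one of the children. *)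
Lemma locally_equiv_parent u v :
    locally_equiv (rcons u false) (rcons v false) ->
    locally_equiv (rcons u true) (rcons v true) ->
  locally_equiv u v.
Proof.
move=> [k ku] [m mu]; exists (maxn k m).+1 => -[|b w] //=.
rewrite ltnS geq_max -!cat_rcons => /andP[kw mw].
by case: b; [apply: mu|apply: ku].
Qed.

(** Extending both words by 00...0, or by 11...1, reaches the ends. *)
Lemma locally_equiv_ends u v : locally_equiv u v ->
  same_orbit (wpoint u 0) (wpoint v 0) /\ same_orbit (wpoint u 1) (wpoint v 1).
Proof.
case=> k kuv; split.
  have [|h Hh hE] := kuv (nseq k false); first by rewrite size_nseq.
  exists h => //; have := hE 0; rewrite !wpoint_cat wpoint_zeros.
  by apply; rewrite lexx ler01.
have [|h Hh hE] := kuv (nseq k true); first by rewrite size_nseq.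
exists h => //; have := hE 1; rewrite !wpoint_cat wpoint_ones.
by apply; rewrite lexx ler01.
Qed.

Variables (I : Type) (D : I -> tree_pair).
Hypothesis hD : forall i, exists2 f, H f & represents (D i) f.
Local Notation K := (core_of_diagrams D).
Local Notation p := (distinguished K).

(** The word of a path of cells from p to the edge. *)
Definition edge_word (e : pre_edge D) : word :=
  match e with PEdge => [::] | DEdge i s u _ => u end.

(** The position of a vertex in the domain of its diagram; only its H-orbit
    is meaningful in the core. *)
Definition vertex_point (v : pre_vertex D) : R :=
  match v with
  | PInitial => 0
  | PTerminal => 1
  | DVertex i j => leaf_point R (tree_plus (D i)) j
  end.

(** [fold_edge] is the least equivalence containing the gluings and closed
    under foldings, so it suffices that local equivalence has these
    properties; the gluing of two leaves is realized by the element of H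
    that the diagram represents. *)
Lemma fold_edge_locally_equiv (e e' : pre_edge D) :
  @fold_edge (pre_core D) (@core_glue I D) e e' ->
  locally_equiv (edge_word e) (edge_word e').
Proof.
elim=> {e e'}.
- move=> e e' [i j u v hu hv jD uE vE|i s h] /=; last exact: locally_equiv_refl.
  have [f Hf Df] := hD i; apply: (locally_equiv_linear Hf).
  by apply/linear_onP; rewrite uE vE; apply: Df.
- by move=> e; apply: locally_equiv_refl.
- by move=> e e' _; apply: locally_equiv_sym.
- by move=> e e' e'' _ h _; apply: locally_equiv_trans h.
- by move=> [i s u hu] [i' s' u' hu'] _; apply: locally_equiv_child.
- by move=> [i s u hu] [i' s' u' hu'] _; apply: locally_equiv_child.
- by move=> [i s u hu] [i' s' u' hu'] _ h _; apply: locally_equiv_parent h.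
Qed.

Lemma walk_locally_equiv u e :
  walk p u (edge_class e) -> locally_equiv u (edge_word e).
Proof.
elim/last_ind: u e => [|u b IHu] e.
  by move=> /(edge_classP (PEdge D) e)/fold_edge_locally_equiv.
case/walk_rcons=> c; have [[i s v hv] ->] := cell_class_rep c.
rewrite top_class lower_class => /IHu uv.
move=> /edge_classP/fold_edge_locally_equiv.
by apply: locally_equiv_trans; case: b; apply: locally_equiv_child uv.
Qed.

Lemma pre_edge_ends (e : pre_edge D) :
  same_orbit (vertex_point (pre_initial e)) (wpoint (edge_word e) 0) /\
  same_orbit (vertex_point (pre_terminal e)) (wpoint (edge_word e) 1).
Proof.
case: e => [|i s u hu] /=.
  by rewrite !wpoint_nil; split; apply: same_orbit_refl.
have [e0 e1] := node_ends R hu; rewrite -{}e0 -{}e1.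
case: s hu => hu; first by split; apply: same_orbit_refl.
have [f Hf Df] := hD i; have f1 := thompsonF1 (HF Hf).
by split; exists f => //; rewrite (represents_leaf_point _ Df f1).
Qed.

(** Each vertex of the core has a well-defined H-orbit of points, as
    identified vertices are ends of identified edges. *)
Lemma vertex_class_orbit (v v' : pre_vertex D) :
  vertex_class v = vertex_class v' ->
  same_orbit (vertex_point v) (vertex_point v').
Proof.
move/clsP; elim=> {v v'} [v v' [e e'|e e'] h|v|v v' _|v v' v'' _ h1 _ h2].
- have [+ _] := locally_equiv_ends (fold_edge_locally_equiv h).
  have [h1 _] := pre_edge_ends e; have [h2 _] := pre_edge_ends e'.
  by move/(same_orbit_trans h1)/same_orbit_trans; apply; apply: same_orbit_sym.
- have [_] := locally_equiv_ends (fold_edge_locally_equiv h).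
  have [_ h1] := pre_edge_ends e; have [_ h2] := pre_edge_ends e'.
  by move/(same_orbit_trans h1)/same_orbit_trans; apply; apply: same_orbit_sym.
- exact: same_orbit_refl.
- exact: same_orbit_sym.
- exact: same_orbit_trans h1 h2.
Qed.

Lemma terminal_orbit u e (v : pre_vertex D) : walk p u e ->
  terminal e = vertex_class v -> same_orbit (vertex_point v) (wpoint u 1).
Proof.
have [{}e ->] := edge_class_rep e.
move=> /walk_locally_equiv/locally_equiv_ends[_ h].
rewrite terminal_class => /vertex_class_orbit/same_orbit_sym hv.
have [_ he] := pre_edge_ends e.
by apply: same_orbit_trans hv (same_orbit_trans he _); apply: same_orbit_sym.
Qed.

(** The orbits of 0 and of 1 are singletons, and the dyadic fraction .u1, the
    right end of [u0], is neither. *)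
Lemma terminal_inner u e :
  walk p (rcons u false) e -> inner_vertex (terminal e).
Proof.
move=> ue; have := wpoint_inside u (half_inside R).
have uE : wpoint (rcons u false) 1 = wpoint u 2^-1 :> R.
  by rewrite wpoint_rcons add0r mul1r.
rewrite -uE => /andP[u0 u1]; split; rewrite ?iota_class ?tau_class.
  by move=> /(terminal_orbit ue)/same_orbit_from0 uE0; rewrite uE0 ltxx in u0.
by move=> /(terminal_orbit ue)/same_orbit_from1 uE1; rewrite uE1 ltxx in u1.
Qed.

(** The fraction .u1 is the right end of [u0], and u0 is readable, so .u1 lies in
    the orbit attached to an inner vertex. There is one such vertex only. *)
Lemma transitive_of_core :
  every_edge_is_top K -> unique_inner_vertex K -> transitive_on_dyadics H.
Proof.
move=> Kt [z [_ zU]] x y /dyadic01_wpoint[u ->] /dyadic01_wpoint[v ->].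
have [z' zE] := vertex_class_rep z.
have orb w : same_orbit (vertex_point z') (wpoint w 2^-1).
  have [e we] := walk_total p (rcons w false) Kt.
  have := terminal_orbit we (_ : _ = vertex_class z'); rewrite wpoint_rcons.
  by rewrite add0r mul1r -zE; apply; apply/esym/zU/(terminal_inner we).
exact: same_orbit_trans (same_orbit_sym (orb u)) (orb v).
Qed.

End Orbits.

Lemma cat_prefix (T : eqType) (s t s' t' : seq T) :
  s ++ t = s' ++ t' -> (size s <= size s')%N ->
  s' = s ++ drop (size s) s' /\ t = drop (size s) s' ++ t'.
Proof.
move=> st ss; have s'E : s' = s ++ drop (size s) s'.
  rewrite -[s' in LHS](cat_take_drop (size s)); congr cat.
  by move: st => /(congr1 (take (size s))); rewrite take_size_cat // takel_cat.
split=> //; move: st => /eqP.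
by rewrite [in X in X -> _]s'E -catA eqseq_cat // eqxx => /eqP.
Qed.

(** * Pairs of branches accepted by a complex *)
Section Branches.
Variables (R : realType) (K : complex).
Implicit Types (f g : R -> R) (B : word -> word -> Prop) (u v w : word).
Local Notation p := (distinguished K).

(** A linear piece of f that the complex recognizes, as the two words lead
    from the distinguished edge to the same edge. *)
Definition branch f u v : Prop :=
  linear_on f u v /\ exists2 e, walk p u e & walk p v e.

(** All long words have a short prefix that is the first member of a pair in
    B. The bound on the prefix keeps a tail of controlled length when
    two such relations are composed. *)
Definition covers B : Prop := exists k, forall w, (k <= size w)%N ->
  exists u v t, [/\ w = u ++ t, (size u <= k)%N & B u v].

Lemma branch_cat f u v t e : deterministic K ->
    branch f u v -> walk p (v ++ t) e ->
  linear_on f (u ++ t) (v ++ t) /\ walk p (u ++ t) e.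
Proof.
move=> Kd [fuv [m um vm]] /walk_cat[m' vm' te].
split; first exact: linear_on_cat.
by apply/walk_cat; exists m; rewrite // (walk_fun Kd vm vm').
Qed.

Lemma branch_inv f g u v : cancel f g -> branch f u v -> branch g v u.
Proof.
by move=> fK [fuv [e ue ve]]; split; [apply: linear_on_cancel fuv|exists e].
Qed.

Lemma branch_comp f g u v t z : deterministic K ->
  branch f u v -> branch g (v ++ t) z -> branch (g \o f) (u ++ t) z.
Proof.
move=> Kd [fuv [e ue ve]] [gvz [e' ve' ze']]; split.
  by apply: linear_on_comp gvz; apply: linear_on_cat.
exists e' => //; case/walk_cat: ve' => m vm te; apply/walk_cat; exists m => //.
by rewrite (walk_fun Kd vm ve).
Qed.

Lemma branch_comp_inv f g u v t z : deterministic K ->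
  branch f u (v ++ t) -> branch g v z -> branch (g \o f) u (z ++ t).
Proof.
move=> Kd [fuv [e ue ve]] [gvz [e' ve' ze']]; split.
  by apply: linear_on_comp fuv _; apply: linear_on_cat.
exists e => //; case/walk_cat: ve => m vm te; apply/walk_cat; exists m => //.
by rewrite (walk_fun Kd vm ve').
Qed.

(** Reading on after a first pair (u, v), either v must be extended to match
    the second pair or it already extends the first member of that pair; these
    are the two hypotheses on B3. *)
Lemma covers_comp B1 B2 B3 :
    (forall u v t z, B1 u v -> B2 (v ++ t) z -> B3 (u ++ t) z) ->
    (forall u v t z, B1 u (v ++ t) -> B2 v z -> B3 u (z ++ t)) ->
  covers B1 -> covers B2 -> covers B3.
Proof.
move=> B123 B123' [k kB] [m mB]; exists (k + m)%N => w kmw.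
have [|u [v [t [wE uk uv]]]] := kB w.
  by apply: leq_trans kmw; apply: leq_addr.
have [|v' [z [t' [vE vm vz]]]] := mB (v ++ t).
  by move: kmw; rewrite wE !size_cat; lia.
have [vv|/ltnW vv] := leqP (size v) (size v').
  have [v'E tE] := cat_prefix vE vv; rewrite v'E in vz.
  exists (u ++ drop (size v) v'), z, t'; split; first by rewrite wE tE catA.
    by rewrite size_cat size_drop; lia.
  exact: B123 uv vz.
have [vE' _] := cat_prefix (esym vE) vv.
exists u, (z ++ drop (size v') v), t; split=> //; first by lia.
by apply: B123' vz; rewrite -vE'.
Qed.

(** Covering both the domain and the range makes the property stable under
    inversion. *)
Definition covered f : Prop :=
  covers (branch f) /\ covers (fun v u => branch f u v).

Lemma covered_id : covered id.
Proof.
by split; exists 0%N => w _; exists [::], [::], w; split=> //;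
   split=> //; exists p.
Qed.

Lemma covered_comp f g : deterministic K ->
  covered f -> covered g -> covered (g \o f).
Proof.
move=> Kd [f1 f2] [g1 g2]; split.
  apply: covers_comp f1 g1 => u v t z; first exact: branch_comp.
  exact: branch_comp_inv.
apply: covers_comp g2 f2 => u v t z.
  by move=> h1 h2; apply: branch_comp_inv h1.
by move=> h1 h2; apply: branch_comp h1.
Qed.

Lemma covered_inv f g : cancel f g -> covered f -> covered g.
Proof.
move=> fK [[k1 f1] [k2 f2]]; split.
  exists k2 => w /f2[u [v [t [wE uk uv]]]]; exists u, v, t; split=> //.
  exact: branch_inv uv.
exists k1 => w /f1[u [v [t [wE uk uv]]]]; exists u, v, t; split=> //.
exact: branch_inv uv.
Qed.

End Branches.

Lemma leaf_prefix T : exists k, forall w, (k <= size w)%N ->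
  exists j t, [/\ (j < size (leaves T))%N, w = nth [::] (leaves T) j ++ t &
                  (size (nth [::] (leaves T) j) <= k)%N].
Proof.
suff [k kT] : exists k, forall w, (k <= size w)%N ->
    exists u t, [/\ u \in leaves T, w = u ++ t & (size u <= k)%N].
  exists k => w /kT[u [t [/(nthP [::])[j jT <-] wE uk]]].
  by exists j, t.
elim: T => [|l [k kl] r [m mr]].
  by exists 0%N => w _; exists [::], w; rewrite inE.
exists (maxn k m).+1 => -[|b w] //=; rewrite ltnS geq_max => /andP[kw mw].
case: b.
  have [u [t [uT -> um]]] := mr w mw; exists (true :: u), t; split=> //=.
    by rewrite mem_cat (map_f (cons true)) ?orbT.
  by rewrite ltnS (leq_trans um) // leq_maxr.
have [u [t [uT -> uk]]] := kl w kw; exists (false :: u), t; split=> //=.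
  by rewrite mem_cat (map_f (cons false)).
by rewrite ltnS (leq_trans uk) // leq_maxl.
Qed.

(** Separates the part of a word that determines the right end of its
    interval, when that end is less than 1, from the letters 1 that do not
    move it. *)
Lemma trailing_ones (u : word) : exists n,
  u = nseq n true \/ exists v, u = rcons v false ++ nseq n true.
Proof.
elim/last_ind: u => [|u [] [n nE]]; first by exists 0%N; left.
  exists (n + 1)%N; rewrite nseqD -cats1.
  case: nE => [->|[v ->]]; first by left.
  by right; exists v; rewrite catA.
by exists 0%N; right; exists u; rewrite cats0.
Qed.

Lemma wpoint_trailing_ones (R : realType) v n :
  wpoint (rcons v false ++ nseq n true) 1 = wpoint v (2^-1 : R).
Proof. by rewrite wpoint_cat wpoint_ones wpoint_rcons add0r mul1r. Qed.

(** * The core of a transitive subgroup *)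
Section Forward.
Variables (R : realType) (H S : set (R -> R)) (I : Type) (D : I -> tree_pair).
Hypothesis hH : thompson_subgroup H.
Hypothesis hS : H = smallest (@thompson_subgroup R) S.
Hypothesis hD : forall i, exists2 f, H f & represents (D i) f.
Hypothesis hSD : forall f, S f -> exists i, represents (D i) f.
Local Notation K := (core_of_diagrams D).
Local Notation p := (distinguished K).

Lemma represented_covered f i : represents (D i) (f : R -> R) -> covered K f.
Proof.
move=> Df; pose u_ := nth [::] (leaves (tree_plus (D i))).
pose v_ := nth [::] (leaves (tree_minus (D i))).
have br j : (j < nleaves (D i))%N -> branch K f (u_ j) (v_ j).
  by move=> jD; split; [exact/linear_onP/Df|exact: walk_leaves].
split.
  have [k kT] := leaf_prefix (tree_plus (D i)).
  exists k => w /kT[j [t [jT wE jk]]].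
  by exists (u_ j), (v_ j), t; split=> //; apply: br.
have [k kT] := leaf_prefix (tree_minus (D i)).
exists k => w /kT[j [t [jT wE jk]]].
exists (v_ j), (u_ j), t; split=> //.
by apply: br; rewrite /nleaves size_leaves.
Qed.

(** The covered elements of H form a subgroup, and it contains the generators
    as their own diagrams are part of the core. *)
Lemma subgroup_covered (f : R -> R) : H f -> covered K f.
Proof.
have Kd := core_deterministic (D := D).
suff HP : H `<=` [set f | H f /\ covered K f] by move=> /HP[].
rewrite [X in X `<=` _]hS; apply: smallest_sub; last first.
  move=> g Sg; split; first by rewrite hS; apply: sub_gen_smallest.
  by have [i /represented_covered] := hSD Sg.
case: (hH) => HF Hid Hc Hi; split.
- by move=> g [/HF].
- by split=> //; apply: covered_id.
- move=> g h [Hg cg] [Hh ch]; split; first exact: Hc.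
  exact: covered_comp.
- move=> g h [Hg cg] gK hK; split; first exact: (Hi g).
  exact: covered_inv gK cg.
Qed.

Lemma subgroup_injective f : H f -> injective f.
Proof. by move=> /(subgroup_inverse hH)[g [_ fK _]]; apply: can_inj fK. Qed.

(** A linear map of intervals maps midpoint to midpoint, and midpoints determine
    words. *)
Lemma half_preimage f u v w :
  H f -> f (wpoint u 2^-1) = wpoint w 2^-1 -> linear_on f v w -> v = u.
Proof.
move=> Hf fu fv; apply: (@wpoint_half_inj R); apply: (subgroup_injective Hf).
by rewrite fu fv //; have := half_inside R; lra.
Qed.

(** Suppose that an edge E, read by w, is not a top edge. The core reads no
    proper extension of w, so any branch of an f in H whose target meets the
    interior of [w] has a prefix of w as target, and w itself is the target of
    a branch of f. The source of the latter is z if f(.z1) = .w1. By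
    transitivity every word z then reads E, the empty word and the word 0
    among them; so E = p, which is a top edge. *)
Lemma top_of_transitive : transitive_on_dyadics H -> every_edge_is_top K.
Proof.
move=> Ht E; apply: contrapT => Etop; have [w wE] := edge_reachable E.
have Kd := core_deterministic (D := D).
have all_E z : walk p z E.
  have [f Hf fz] := Ht _ _ (dyadic01_half R z) (dyadic01_half R w).
  have [_ [k kf]] := subgroup_covered Hf.
  have [|v [u [t [wt _ uv]]]] := kf (w ++ nseq k false).
    by rewrite size_cat size_nseq leq_addl.
  have [vw|vw] := leqP (size v) (size w).
    have [wv _] := cat_prefix (esym wt) vw; rewrite wv in wE.
    have [fuw uE] := branch_cat Kd uv wE.
    (* The branch extends to one onto w, whose source must be z. *)
    by rewrite -wv in fuw; rewrite -(half_preimage Hf fz fuw).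
  (* Otherwise v is a readable proper extension of w, so the walk goes
     through a cell with top edge E. *)
  have [vw' _] := cat_prefix wt (ltnW vw).
  have [_ [e _]] := uv; rewrite vw' => /walk_cat[m wm].
  rewrite -(walk_fun Kd wE wm); case: (drop _ _) (size_drop (size w) v).
    by move: vw => + /= /esym/eqP; rewrite -subn_gt0 lt0n => /negP.
  by move=> b s _ [c cE _]; case: Etop; exists c.
have /(walk_fun Kd (all_E [::]))pE := erefl p.
by have [c cE _] := all_E [:: false]; case: Etop; exists c; rewrite cE.
Qed.

(** Two inner vertices are the terminal vertices of edges read by words u0 and
    v0. An f in H taking the right end of [u0] to that of [v0] has a branch onto
    some word v01...1; the interval of its source has the same right end as
    [u0], so the source has the form u01...1. Both words read one edge, and its
    terminal vertex is unaffected by the trailing letters 1. *)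
Lemma inner_unique (z1 z2 : vertex K) : transitive_on_dyadics H ->
  inner_vertex z1 -> inner_vertex z2 -> z1 = z2.
Proof.
move=> Ht /inner_terminal[u1 [e1 [ue1 <-]]] /inner_terminal[u2 [e2 [ue2 <-]]].
have Kd := core_deterministic (D := D); have Kt := top_of_transitive Ht.
have [f Hf fu] := Ht _ _ (dyadic01_half R u1) (dyadic01_half R u2).
have [_ [k kf]] := subgroup_covered Hf.
have [|v [u [t [wt _ uv]]]] := kf (rcons u2 false ++ nseq k true).
  by rewrite size_cat size_nseq leq_addl.
have [e we] := walk_total p (rcons u2 false ++ nseq k true) Kt.
have <- : terminal e = terminal e2.
  by case/walk_cat: we => m /(walk_fun Kd ue2) <- /walk_ones.
rewrite wt in we; have [fuw ue] := branch_cat Kd uv we.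
have u1E : wpoint (u ++ t) 1 = wpoint u1 (2^-1 : R).
  apply: (subgroup_injective Hf); rewrite fu fuw ?lexx ?ler01 // -wt.
  exact: wpoint_trailing_ones.
have [n [uE|[v' uE]]] := trailing_ones (u ++ t); rewrite uE in u1E ue.
  have := wpoint_inside u1 (half_inside R).
  by rewrite -u1E wpoint_ones ltxx andbF.
rewrite wpoint_trailing_ones in u1E; rewrite (wpoint_half_inj u1E) in ue.
by case/walk_cat: ue => m /(walk_fun Kd ue1) <- /walk_ones.
Qed.

Lemma core_of_transitive : transitive_on_dyadics H ->
  every_edge_is_top K /\ unique_inner_vertex K.
Proof.
move=> Ht; have Kt := top_of_transitive Ht; split=> //.
have [e he] := walk_total p (rcons [::] false) Kt.
have eI := terminal_inner hH hD he.
by exists (terminal e); split=> // z; apply: inner_unique.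
Qed.

End Forward.

Theorem theorem1p2 (R : realType) (H S : set (R -> R))
  (hH : thompson_subgroup H) (hS : H = smallest (@thompson_subgroup R) S) :
  transitive_on_dyadics H <->
  every_edge_is_top (core S) /\ unique_inner_vertex (core S).
Proof.
have SH : S `<=` H by rewrite hS; apply: sub_gen_smallest.
have hD (D : reduced_pairs S) : exists2 f, H f & represents (val D) f.
  by have /set_mem[f /SH Hf [_ Df]] := valP D; exists f.
have hSD f : S f -> exists D : reduced_pairs S, represents (val D) f.
  move=> Sf; case: (hH) => HF _ _ _.
  have [D Dr Df] := thompsonF_reduced_pair (HF _ (SH _ Sf)).
  have DS : D \in reduced_pairs S by apply/mem_set; exists f.
  by exists (SigSub DS).
split; first exact: core_of_transitive hH hS hD hSD.
by case; apply: (transitive_of_core hH hD).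
Qed.
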